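(* Let $(M,\Lambda,E)$ be a Jacobi manifold. Let $TM\times\mathbb R\to M$ carry the Lie algebroid structure $([\,,\,],\pi)$ and its dual $T^*M\times\mathbb R\to M$ the Lie algebroid structure $([\,,\,]_{(\Lambda,E)},\widetilde{\#}_{(\Lambda,E)})$ recalled in the context, with the 1-cocycles $(0,1)\in\Omega^1(M)\times C^\infty(M,\mathbb R)\cong\Gamma(T^*M\times\mathbb R)$ for $TM\times\mathbb R$ and $(-E,0)\in\mathfrak X(M)\times C^\infty(M,\mathbb R)\cong\Gamma(TM\times\mathbb R)$ for $T^*M\times\mathbb R$. Then: (i) For all $(X,f),(Y,g)\in\Gamma(TM\times\mathbb R)\cong\mathfrak X(M)\times C^\infty(M,\mathbb R)$, $$d_{*(-E,0)}[(X,f),(Y,g)]=[(X,f),d_{*(-E,0)}(Y,g)]_{(0,1)}-[(Y,g),d_{*(-E,0)}(X,f)]_{(0,1)}.$$ (ii) For all $k$ and all $(P,Q)\in\Gamma(\wedge^k(TM\times\mathbb R))\cong\mathcal V^k(M)\oplus\mathcal V^{k-1}(M)$, $$(\mathcal L_{*(-E,0)})_{(0,1)}(P,Q)+(\mathcal L_{(0,1)})_{(-E,0)}(P,Q)=0.$$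
   Context: Lie algebroid $(A,[\,,\,],\rho)$ over $M$: real vector bundle $A\to M$, Lie bracket on $\Gamma(A)$, anchor $\rho:A\to TM$ inducing a Lie algebra homomorphism $\Gamma(A)\to\mathfrak X(M)$, with $[X,fY]=f[X,Y]+\rho(X)(f)Y$. Its differential $d:\Gamma(\wedge^kA^* )\to\Gamma(\wedge^{k+1}A^* )$ is $(d\omega)(X_0,\dots,X_k)=\sum_i(-1)^i\rho(X_i)(\omega(\dots,\hat X_i,\dots))+\sum_{i<j}(-1)^{i+j}\omega([X_i,X_j],\dots,\hat X_i,\dots,\hat X_j,\dots)$. $\phi_0\in\Gamma(A^* )$ is a 1-cocycle if $d\phi_0=0$. Schouten bracket on $\Gamma(\wedge^*A)$: the $\mathbb R$-bilinear extension of the bracket with $[X,f]=\rho(X)(f)$, $[P,P']=(-1)^{kk'}[P',P]$, $[P,P'\wedge P'']=[P,P']\wedge P''+(-1)^{k'(k+1)}P'\wedge[P,P'']$ ($k,k'$ the degrees of $P,P'$). The same sign convention is used for the Schouten–Nijenhuis bracket on multivector fields. For a 1-cocycle $\phi_0$ of $A$: the $\phi_0$-differential is $d_{\phi_0}\omega=d\omega+\phi_0\wedge\omega$; the $\phi_0$-Lie derivative on $\Gamma(\wedge^kA^* )$ is $(\mathcal L_{\phi_0})_X=d_{\phi_0}\circ i_X+i_X\circ d_{\phi_0}$; the $\phi_0$-Schouten bracket is $[P,P']_{\phi_0}=[P,P']+(-1)^{k+1}(k-1)P\wedge i_{\phi_0}P'-(k'-1)(i_{\phi_0}P)\wedge P'$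 (contraction in the first slot); and on multisections $P\in\Gamma(\wedge^kA)$, $(\mathcal L_{\phi_0})_XP=[X,P]_{\phi_0}$. Jacobi manifold: a 2-vector $\Lambda$ and vector field $E$ on $M$ with $[\Lambda,\Lambda]=2E\wedge\Lambda$, $[E,\Lambda]=0$. $\mathcal V^k(M)$ denotes $k$-vectors. $A=TM\times\mathbb R$: bracket $[(X,f),(Y,g)]=([X,Y],X(g)-Y(f))$, anchor $\pi(X,f)=X$. The dual is $T^*M\times\mathbb R$ with $(\alpha,f)(X,g)=\alpha(X)+fg$. The space $\Gamma(\wedge^k(TM\times\mathbb R))$ is identified with $\mathcal V^k(M)\oplus\mathcal V^{k-1}(M)$ via $(P,Q)((\alpha_1,f_1),\dots,(\alpha_k,f_k))=P(\alpha_1,\dots,\alpha_k)+\sum_i(-1)^{i+1}f_iQ(\alpha_1,\dots,\hat\alpha_i,\dots,\alpha_k)$. $A^*=T^*M\times\mathbb R$: with $\#_\Lambda$ defined by $\beta(\#_\Lambda(\alpha))=\Lambda(\alpha,\beta)$ and $\delta$ the de Rham differential, the bracket is $$[(\alpha,f),(\beta,g)]_{(\Lambda,E)}=\big(\mathcal L_{\#_\Lambda(\alpha)}\beta-\mathcal L_{\#_\Lambda(\beta)}\alpha-\delta(\Lambda(\alpha,\beta))+f\mathcal L_E\beta-g\mathcal L_E\alpha-i_E(\alpha\wedge\beta),\ \Lambda(\beta,\alpha)+\#_\Lambda(\alpha)(g)-\#_\Lambda(\beta)(f)+fE(g)-gE(f)\big)$$ and the anchor is $\widetilde{\#}_{(\Lambda,E)}(\alpha,f)=\#_\Lambda(\alpha)+fE$.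 $d_*$ is the differential of the Lie algebroid $T^*M\times\mathbb R$ (acting on $\Gamma(\wedge^k(TM\times\mathbb R))$), $d_{*(-E,0)}$ its $(-E,0)$-differential, and $(\mathcal L_{*(-E,0)})_{(0,1)}$ its $(-E,0)$-Lie derivative with respect to the section $(0,1)$ of $T^*M\times\mathbb R$, acting on $\Gamma(\wedge^k(TM\times\mathbb R))$. $[\,,\,]_{(0,1)}$ is the $(0,1)$-Schouten bracket of $TM\times\mathbb R$, and $(\mathcal L_{(0,1)})_{(-E,0)}(P,Q)=[(-E,0),(P,Q)]_{(0,1)}$. *)

(* Defs.v *)
(* Smooth manifolds over a [realType] and the calculus on T M x R that a
   Jacobi structure induces, on top of MathComp-Analysis.

   Sections are handled through the algebra C^oo(M): vector fields are the
   derivations of C^oo(M), 1-forms are the C^oo(M)-linear maps from vector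
   fields to C^oo(M).  A multisection of a bundle is represented by its values
   on sections of the dual bundle: it is a function of a sequence of dual
   sections, equal to 0 off the sequences whose length is the degree. *)
From HB Require Import structures.
From mathcomp Require Import all_boot all_order all_algebra.
From mathcomp Require Import ring.
From mathcomp Require Import all_classical all_reals all_analysis.

Set Implicit Arguments.
Unset Strict Implicit.
Unset Printing Implicit Defensive.

Import Order.TTheory GRing.Theory Num.Theory.
Import numFieldNormedType.Exports.
Local Open Scope classical_set_scope.
Local Open Scope ring_scope.

Section SmoothOn.
Variables (R : realType) (n : nat).
Implicit Types (O : set 'rV[R]_n) (f g : 'rV[R]_n -> R).

Fixpoint Ck_on (k : nat) O f : Prop :=
  (forall x, O x -> {for x, continuous f}) /\
  (if k is k'.+1 then
     forall i : 'I_n,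
       (forall x, O x -> derivable f x (delta_mx 0 i)) /\
       Ck_on k' O (fun x => 'D_(delta_mx 0 i) f x)
   else True).

Definition smooth_on O f := forall k, Ck_on k O f.

Lemma eq_Ck_on k O f g : open O -> (forall x, O x -> f x = g x) ->
  Ck_on k O f -> Ck_on k O g.
Proof.
move=> oO; have near_fg (h h' : 'rV[R]_n -> R) x : (forall y, O y -> h y = h' y) -> O x ->
    {near x, h =1 h'}.
  by move=> hh' Ox; near=> y; apply: hh'; near: y; exact: open_nbhs_nbhs.
have cont (h h' : 'rV[R]_n -> R) x : (forall y, O y -> h y = h' y) -> O x ->
    {for x, continuous h} -> {for x, continuous h'}.
  move=> hh' Ox ch; rewrite /prop_for /continuous_at -(hh' _ Ox).
  by apply: cvg_trans ch; exact: near_eq_cvg (near_fg _ _ _ hh' Ox).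
elim: k f g => [|k IH] f g fg [cf df].
  by split=> // x Ox; exact: cont (cf _ Ox).
split=> [x Ox|i]; first exact: cont (cf _ Ox).
have [dfi Dfi] := df i; split=> [x Ox|].
  by apply: near_eq_derivable (dfi _ Ox); exact: near_fg.
by apply: IH Dfi => x Ox; apply: near_eq_derive; exact: near_fg.
Unshelve. all: by end_near. Qed.

Lemma Ck_onW k O f : Ck_on k.+1 O f -> Ck_on k O f.
Proof.
elim: k f => [|k IH] f [cf df]; split=> // i.
by have [dfi Dfi] := df i; split=> //; apply: IH.
Qed.

Lemma Ck_on_cst k O c : Ck_on k O (cst c).
Proof.
elim: k c => [|k IH] c.
  by split=> // x _; exact: cst_continuous.
split=> [x _|i]; first exact: cst_continuous.
split=> [x _|]; first exact: derivable_cst.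
by rewrite (_ : (fun x => _) = cst 0) //; apply/funext => x; rewrite derive_cst.
Qed.

Lemma Ck_onD k O f g : open O -> Ck_on k O f -> Ck_on k O g -> Ck_on k O (f + g).
Proof.
move=> oO; elim: k f g => [|k IH] f g [cf df] [cg dg].
  by split=> // x Ox; apply: continuousD; [exact: cf|exact: cg].
split=> [x Ox|i]; first by apply: continuousD; [exact: cf|exact: cg].
have [dfi Dfi] := df i; have [dgi Dgi] := dg i.
split=> [x Ox|]; first by apply: derivableD; [exact: dfi|exact: dgi].
by apply: eq_Ck_on (IH _ _ Dfi Dgi) => // x Ox; rewrite deriveD; auto.
Qed.

Lemma Ck_onM k O f g : open O -> Ck_on k O f -> Ck_on k O g -> Ck_on k O (f * g).
Proof.
move=> oO; elim: k f g => [|k IH] f g Cf Cg.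
  case: Cf Cg => [cf _] [cg _].
  by split=> // x Ox; apply: continuousM; [exact: cf|exact: cg].
have [Wf Wg] := (Ck_onW Cf, Ck_onW Cg).
case: Cf Cg => [cf df] [cg dg].
split=> [x Ox|i]; first by apply: continuousM; [exact: cf|exact: cg].
have [dfi Dfi] := df i; have [dgi Dgi] := dg i.
split=> [x Ox|]; first by apply: derivableM; [exact: dfi|exact: dgi].
apply: eq_Ck_on (Ck_onD oO (IH _ _ Wf Dgi) (IH _ _ Wg Dfi)) => // x Ox.
by rewrite deriveM; auto.
Qed.

End SmoothOn.

Record chart (R : realType) (M : topologicalType) (n : nat) := Chart {
  cdom : set M;
  cmap : M -> 'rV[R]_n;
  cinv : 'rV[R]_n -> M;
  cdom_open : open cdom;
  cimg_open : open (cmap @` cdom);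
  cmapK : forall x, cdom x -> cinv (cmap x) = x;
  cmap_continuous : {within cdom, continuous cmap};
  cinv_continuous : {within cmap @` cdom, continuous cinv} }.

Record manifold (R : realType) := Manifold {
  man_space :> topologicalType;
  man_dim : nat;
  atlas : set (chart R man_space man_dim);
  man_hausdorff : hausdorff_space man_space;
  man_second_countable : @second_countable man_space;
  atlas_cover : forall x : man_space, exists2 c, atlas c & cdom c x;
  atlas_compatible : forall c c', atlas c -> atlas c' -> forall i : 'I_man_dim,
    smooth_on (cmap c @` (cdom c `&` cdom c')) (fun y => cmap c' (cinv c y) 0 i) }.

Section SmoothFunctions.
Variables (R : realType) (M : manifold R).

Definition smooth (f : M -> R) : Prop :=
  forall c, atlas c -> smooth_on (cmap c @` cdom c) (f \o cinv c).

Definition smooth_pred : pred (M -> R) := fun f => `[< smooth f >].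

Lemma smooth_subring_closed : subring_closed smooth_pred.
Proof.
have smoothM f g : smooth f -> smooth g -> smooth (f * g).
  by move=> sf sg c ac k; apply: Ck_onM;
     [exact: cimg_open|exact: sf|exact: sg].
have smooth_cst a : smooth (cst a) by move=> c ac k; exact: Ck_on_cst.
split=> [|f g /asboolP sf /asboolP sg|f g /asboolP sf /asboolP sg];
  apply/asboolP; [exact: smooth_cst| |exact: smoothM].
rewrite -mulN1r => c ac k; apply: Ck_onD; first exact: cimg_open.
  exact: sf.
exact: (smoothM _ _ (smooth_cst (-1)) sg).
Qed.

Lemma smooth_scale_closed : GRing.scaler_closed smooth_pred.
Proof.
move=> a f /asboolP sf; apply/asboolP => c ac k.
apply: (@Ck_onM _ _ _ _ (cst a) (f \o cinv c)); first exact: cimg_open.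
  exact: Ck_on_cst.
exact: sf.
Qed.

HB.instance Definition _ :=
  GRing.isSubringClosed.Build (M -> R) smooth_pred smooth_subring_closed.
HB.instance Definition _ :=
  GRing.isScaleClosed.Build R (M -> R) smooth_pred smooth_scale_closed.

Record Cinf := SmoothFun { Cinf_fun :> M -> R; _ : smooth_pred Cinf_fun }.
HB.instance Definition _ := [isSub for Cinf_fun].
HB.instance Definition _ := [Choice of Cinf by <:].
HB.instance Definition _ :=
  GRing.SubChoice_isSubComPzRing.Build (M -> R) smooth_pred Cinf
    smooth_subring_closed.
HB.instance Definition _ := [SubZmodule_isSubLmodule of Cinf by <:].

End SmoothFunctions.

Section VectorFieldsAndForms.
Variables (R : realType) (M : manifold R).
Local Notation S := (Cinf M).

Definition derivation (D : S -> S) : Prop :=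
  (forall (a : R) (f g : S), D (a *: f + g) = a *: D f + D g) /\
  (forall f g : S, D (f * g) = f * D g + D f * g).

(* S^o is S as a module over itself, so that S -> S^o is an S-module. *)
Definition derivation_pred : pred (S -> S^o) := fun D => `[< derivation D >].

Lemma Cinf_scalerAr (a : R) (f g : S) : f * (a *: g) = a *: (f * g).
Proof.
by apply/val_inj/funext => x; rewrite /= /GRing.scale /= /GRing.mul /= mulrCA.
Qed.

Lemma derivation_submod_closed : submod_closed derivation_pred.
Proof.
split; first by apply/asboolP; split=> [a f g|f g];
  rewrite ?scaler0 ?mulr0 ?mul0r ?addr0.
move=> h D D' /asboolP [lD pD] /asboolP [lD' pD']; apply/asboolP; split.
  move=> a f g.
  have -> u : (h *: D + D') u = h * D u + D' u :> S by [].
  by rewrite lD lD' scalerDr mulrDr Cinf_scalerAr addrACA.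
move=> f g.
have E u : (h *: D + D') u = h * D u + D' u :> S by [].
rewrite !E pD pD' !mulrDr !mulrDl addrACA; congr (_ + _ + (_ + _)).
  by rewrite mulrCA.
by rewrite mulrA.
Qed.

HB.instance Definition _ :=
  GRing.isSubmodClosed.Build S (S -> S^o) derivation_pred
    (GRing.submod_closed_semi derivation_submod_closed).

Record vfield := VField { vfield_fun :> S -> S^o; _ : derivation_pred vfield_fun }.
HB.instance Definition _ := [isSub for vfield_fun].
HB.instance Definition _ := [Choice of vfield by <:].
HB.instance Definition _ := [SubChoice_isSubLmodule of vfield by <:].

Definition oneform_pred : pred (vfield -> S^o) :=
  fun alpha => `[< linear alpha >].

Lemma oneform_submod_closed : submod_closed oneform_pred.
Proof.
split; first by apply/asboolP => h X Y; rewrite scaler0 addr0.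
move=> h a b /asboolP la /asboolP lb; apply/asboolP => u X Y.
have E Z : (h *: a + b) Z = h *: a Z + b Z by [].
rewrite !E la lb !scalerDr addrACA; congr (_ + _ + _).
by rewrite !scalerA mulrC.
Qed.

HB.instance Definition _ :=
  GRing.isSubmodClosed.Build S (vfield -> S^o) oneform_pred
    (GRing.submod_closed_semi oneform_submod_closed).

Record oneform := OneForm { oneform_fun :> vfield -> S^o; _ : oneform_pred oneform_fun }.
HB.instance Definition _ := [isSub for oneform_fun].
HB.instance Definition _ := [Choice of oneform by <:].
HB.instance Definition _ := [SubChoice_isSubLmodule of oneform by <:].

Lemma vfield_linear (X : vfield) (a : R) (f g : S) :
  X (a *: f + g) = a *: (X f : S) + X g.
Proof. by have /asboolP[l _] := valP X; exact: l. Qed.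

Lemma vfieldM (X : vfield) (f g : S) : X (f * g) = f * X g + X f * g :> S.
Proof. by have /asboolP[_ l] := valP X; exact: l. Qed.

Lemma vfieldD (X : vfield) (f g : S) : X (f + g) = X f + X g.
Proof. by have := vfield_linear X 1 f g; rewrite !scale1r. Qed.

Lemma oneform_linear (alpha : oneform) : linear alpha.
Proof. by have /asboolP := valP alpha. Qed.

Lemma vlie_subproof (X Y : vfield) :
  derivation_pred (fun f => X (Y f) - Y (X f)).
Proof.
apply/asboolP; split=> [a f g|f g].
  rewrite !vfield_linear opprD addrACA; congr (_ + _).
  exact: esym (scalerBr a (X (Y f) : S) (Y (X f) : S)).
rewrite !vfieldM !vfieldD !vfieldM mulrBr mulrBl !opprD.
set a := f * X (Y g); set b := X f * Y g; set c := Y f * X g.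
set d := X (Y f) * g; set a' := f * Y (X g); set d' := Y (X f) * g.
ring.
Qed.

Definition vlie (X Y : vfield) : vfield := VField (vlie_subproof X Y).

Lemma dfun_subproof (f : S) : oneform_pred (fun X : vfield => X f).
Proof. by apply/asboolP => h X Y. Qed.

Definition dfun (f : S) : oneform := OneForm (dfun_subproof f).

Lemma lieform_subproof (X : vfield) (alpha : oneform) :
  oneform_pred (fun Y => X (alpha Y) - alpha (vlie X Y)).
Proof.
apply/asboolP => h Y Z.
have -> : vlie X (h *: Y + Z) = h *: vlie X Y + ((X h : S) *: Y + vlie X Z).
  apply/val_inj/funext => f.
  change (X (h * Y f + Z f) - (h * Y (X f) + Z (X f)) =
    h * (X (Y f) - Y (X f)) + (X h * Y f + (X (Z f) - Z (X f))) :> S).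
  by rewrite vfieldD vfieldM; ring.
rewrite !oneform_linear.
change (X (h * alpha Y + alpha Z) -
  (h * alpha (vlie X Y) + (X h * alpha Y + alpha (vlie X Z))) =
  h * (X (alpha Y) - alpha (vlie X Y)) +
  (X (alpha Z) - alpha (vlie X Z)) :> S).
by rewrite vfieldD vfieldM; ring.
Qed.

Definition lieform (X : vfield) (alpha : oneform) : oneform :=
  OneForm (lieform_subproof X alpha).

End VectorFieldsAndForms.

Section Multisections.
Variables (R : realType) (M : manifold R).
Local Notation S := (Cinf M).

Definition sec0 (T : Type) (f : S) : seq T -> S :=
  fun s => if s is [::] then f else 0.

(* A mask m of s selects the arguments given to P, the others go to Q, both in
   increasing order; [inversions m] is the parity of this shuffle. *)
Definition inversions (m : bitseq) : nat :=
  \sum_(j < size m | nth false m j) count negb (take j m).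

(* With this normalization (alpha /\ beta)(X, Y) is
   alpha(X) beta(Y) - alpha(Y) beta(X). *)
Definition wedge (T : Type) (P Q : seq T -> S) : seq T -> S :=
  fun s => \sum_(m : (size s).-tuple bool)
    (-1) ^+ inversions m * P (mask m s) * Q (mask (map negb m) s).

Definition contr (T : Type) (x : T) (P : seq T -> S) : seq T -> S :=
  fun s => P (x :: s).

Definition delete (T : Type) (i : nat) (s : seq T) : seq T :=
  take i s ++ drop i.+1 s.

Section Dual.
(* V and W are the sections of a bundle A and of its dual. *)
Variables (V W : Type) (pairing : V -> W -> S).

Definition sec1 (X : V) : seq W -> S :=
  fun s => if s is [:: alpha] then pairing X alpha else 0.

(* Gamma(/\^k A) is the k-th exterior power over C^oo(M) of Gamma(A), since A
   has finite rank over a second countable manifold; an element of it is a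
   finite sum of terms f X_1 /\ ... /\ X_k. *)
Definition multisection (k : nat) (P : seq W -> S) : Prop :=
  exists l : seq (S * k.-tuple V),
    P = fun s => \sum_(t <- l)
      t.1 * foldr (@wedge W) (sec0 1) [seq sec1 X | X <- t.2] s.

(* sb is the Schouten bracket of A, in the sign convention where
   [P, P'] = (-1)^(k k') [P', P].  Two functions have bracket 0 because the
   bracket has degree -1.  The values of sb off the multisections are
   irrelevant. *)
Record is_schouten (rho : V -> vfield M) (br : V -> V -> V)
    (sb : (seq W -> S) -> (seq W -> S) -> (seq W -> S)) : Prop := IsSchouten {
  schouten_deg : forall k k' n P P', multisection k P -> multisection k' P' ->
    n.+1 = (k + k')%N -> multisection n (sb P P');
  schouten_linearl : forall k k' (a : R) P1 P2 P',
    multisection k P1 -> multisection k P2 -> multisection k' P' ->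
    sb (a *: P1 + P2) P' = a *: sb P1 P' + sb P2 P';
  schouten_linearr : forall k k' (a : R) P P1 P2,
    multisection k P -> multisection k' P1 -> multisection k' P2 ->
    sb P (a *: P1 + P2) = a *: sb P P1 + sb P P2;
  schouten_sec : forall X Y, sb (sec1 X) (sec1 Y) = sec1 (br X Y);
  schouten_fun : forall X f, sb (sec1 X) (sec0 f) = sec0 (rho X f);
  schouten_fun_fun : forall f g, sb (sec0 f) (sec0 g) = 0;
  schouten_comm : forall k k' P P', multisection k P -> multisection k' P' ->
    sb P P' = ((-1) ^+ (k * k') : R) *: sb P' P;
  schouten_wedge : forall k k' k'' P P' P'',
    multisection k P -> multisection k' P' -> multisection k'' P'' ->
    sb P (wedge P' P'') =
      wedge (sb P P') P'' +
      ((-1) ^+ (k' * k.+1) : R) *: wedge P' (sb P P'') }.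

(* [P, P']_phi for P of degree k and P' of degree k' *)
Definition twisted_schouten
    (sb : (seq W -> S) -> (seq W -> S) -> (seq W -> S)) (phi : W)
    (k k' : nat) (P P' : seq W -> S) : seq W -> S :=
  sb P P' + ((-1) ^+ k.+1 * (k%:R - 1) : R) *: wedge P (contr phi P')
          - (k'%:R - 1 : R) *: wedge (contr phi P) P'.

End Dual.

Section Differential.
Variables (V : Type) (rho : V -> vfield M) (br : V -> V -> V).

Definition differential (omega : seq V -> S) : seq V -> S := fun s =>
  \sum_(i < size s)
    (-1) ^+ i * (rho (tnth (in_tuple s) i) (omega (delete i s)) : S) +
  \sum_(i < size s) \sum_(j < size s | (i < j)%N)
    (-1) ^+ (i + j) * omega (br (tnth (in_tuple s) i) (tnth (in_tuple s) j)
                               :: delete i (delete j s)).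

Definition twisted_differential (phi omega : seq V -> S) : seq V -> S :=
  differential omega + wedge phi omega.

Definition twisted_Lie (phi : seq V -> S) (X : V) (omega : seq V -> S) :
    seq V -> S :=
  twisted_differential phi (contr X omega) +
  contr X (twisted_differential phi omega).

End Differential.
End Multisections.

Section Jacobi.
Variables (R : realType) (M : manifold R).
Local Notation S := (Cinf M).

Definition tm_pairing (X : vfield M) (alpha : oneform M) : S := alpha X.

Definition multivector : nat -> (seq (oneform M) -> S) -> Prop :=
  multisection tm_pairing.

(* sb is the Schouten-Nijenhuis bracket of M. *)
Definition is_jacobi
    (sb : (seq (oneform M) -> S) -> (seq (oneform M) -> S) ->
          (seq (oneform M) -> S))
    (Lambda : seq (oneform M) -> S) (E : vfield M) : Prop :=
  [/\ multivector 2 Lambda,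
      sb Lambda Lambda = (2 : R) *: wedge (sec1 tm_pairing E) Lambda &
      sb (sec1 tm_pairing E) Lambda = 0].

(* Gamma(T M x R) and Gamma(T^* M x R) *)
Definition tmr : Type := (vfield M * S)%type.
Definition tmr_dual : Type := (oneform M * S)%type.

Definition tmr_pairing (U : tmr) (a : tmr_dual) : S := a.1 U.1 + a.2 * U.2.

Definition tmr_anchor (U : tmr) : vfield M := U.1.

Definition tmr_bracket (U V : tmr) : tmr :=
  (vlie U.1 V.1, (U.1 V.2 : S) - V.1 U.2).

(* The k-section (P, Q) of T M x R, for P in V^k(M) and Q in V^{k-1}(M). *)
Definition mvpair (P Q : seq (oneform M) -> S) : seq tmr_dual -> S := fun s =>
  P (map fst s) +
  \sum_(i < size s)
    (-1) ^+ i * (tnth (in_tuple s) i).2 * Q (map fst (delete i s)).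

(* Q in V^{k-1}(M), with V^{-1}(M) = 0 *)
Definition multivector_pred (k : nat) (Q : seq (oneform M) -> S) : Prop :=
  if k is k'.+1 then multivector k' Q else Q = 0.

Variables (Lambda : seq (oneform M) -> S) (E : vfield M).

(* The vector field X with beta(X) = Lambda(alpha, beta) for all beta. *)
Definition sharp (alpha : oneform M) : vfield M :=
  xget 0 [set X : vfield M |
    forall beta : oneform M, beta X = Lambda [:: alpha; beta]].

Definition dual_anchor (a : tmr_dual) : vfield M := sharp a.1 + a.2 *: E.

(* i_E(alpha /\ beta) is alpha(E) beta - beta(E) alpha. *)
Definition dual_bracket (a b : tmr_dual) : tmr_dual :=
  let: (alpha, f) := a in
  let: (beta, g) := b in
  (lieform (sharp alpha) beta - lieform (sharp beta) alpha
     - dfun (Lambda [:: alpha; beta])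
     + f *: lieform E beta - g *: lieform E alpha
     - ((alpha E : S) *: beta - (beta E : S) *: alpha),
   Lambda [:: beta; alpha] + (sharp alpha g : S) - sharp beta f
     + f * E g - g * E f).

(* The (-E,0)-differential and (-E,0)-Lie derivative of T^* M x R, acting on
   the multisections of T M x R. *)
Definition dstar : (seq tmr_dual -> S) -> (seq tmr_dual -> S) :=
  twisted_differential dual_anchor dual_bracket (sec1 tmr_pairing (- E, 0)).

Definition Lstar : tmr_dual -> (seq tmr_dual -> S) -> (seq tmr_dual -> S) :=
  twisted_Lie dual_anchor dual_bracket (sec1 tmr_pairing (- E, 0)).

End Jacobi.

(* Main.v *)
(* On multisections the Schouten bracket with a section U is forced by its axioms
   to be the Lie derivative L_U.  For (ii), Cartan's formula for alternating
   functions turns the (-E,0)-Lie derivative along (0,1) into L_E, as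
   [(0,1), (beta, g)] = (L_E beta, E g) and (-E,0) pairs to 0 with (0,1), while
   the bracket with (-E,0) is - L_E.  For (i), a section (Y, g) has
     d_{*(-E,0)}(Y, g) = (- L_Y Lambda + g Lambda, #(dg) + [E,Y] + g E),
   so both sides are 2-sections whose values are compared by means of
   L_[X,Y] = L_X L_Y - L_Y L_X and the Jacobi identity for vector fields. *)
Require Import Defs.
From mathcomp Require Import all_boot all_order all_algebra.
From mathcomp Require Import ring.
From mathcomp Require Import all_classical all_reals all_analysis.
Import GRing.Theory.
Local Open Scope ring_scope.

Set Implicit Arguments.
Unset Strict Implicit.
Unset Printing Implicit Defensive.

(** * Deletion, shuffle parity and sums over masks *)

Lemma size_delete (T : Type) i (s : seq T) :
  (i < size s)%N -> size (delete i s) = (size s).-1.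
Proof.
move=> si; rewrite /delete size_cat size_take si size_drop.
by case: (size s) si => // n; rewrite ltnS subSS => /subnKC.
Qed.

(** A leading [false] precedes every later [true] and so adds one inversion for each of them; a
    leading [true] adds none. *)
Lemma inversions_cons (b : bool) (m : bitseq) :
  inversions (b :: m) = ((~~ b) * count id m + inversions m)%N.
Proof.
rewrite /inversions /= big_mkcond big_ord_recl /= if_same add0n -big_mkcond /=.
rewrite big_split /=; congr (_ + _)%N.
rewrite sum_nat_const mulnC; congr (_ * _)%N.
rewrite -sum1_card big_mkcond /= -sum1_count.
rewrite [RHS](big_nth false) big_mkord.
by rewrite -big_mkcond.
Qed.

Lemma big_tuple_cons (V : nmodType) (n : nat) (F : n.+1.-tuple bool -> V) :
  \sum_(t : n.+1.-tuple bool) F t =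
  \sum_(t : n.-tuple bool) F [tuple of true :: t] +
  \sum_(t : n.-tuple bool) F [tuple of false :: t].
Proof.
have bij : bijective (fun p : bool * n.-tuple bool => [tuple of p.1 :: p.2]).
  exists (fun t : n.+1.-tuple bool => (thead t, [tuple of behead t])).
    by move=> [b t]; congr pair; apply/val_inj.
  by move=> t; rewrite [RHS]tuple_eta.
rewrite (reindex _ (onW_bij _ bij)) /=.
rewrite -(pair_bigA _ (fun (b : bool) (t : n.-tuple bool) => F [tuple of b :: t])) /=.
by rewrite big_bool.
Qed.

(** * Calculus of vector fields and 1-forms *)

Section FieldsAndForms.
Variables (R : realType) (M : manifold R).
Local Notation S := (Cinf M).
Implicit Types (X Y Z : vfield M) (f g : S) (al be : oneform M).

Lemma vfield0 X : X 0 = 0 :> S.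
Proof. by apply: (addrI (X 0 : S)); rewrite addr0 -[LHS]vfieldD addr0. Qed.

Lemma vfieldN X f : X (- f) = - X f :> S.
Proof. by apply/eqP; rewrite -addr_eq0 -[_ + _](vfieldD X) addNr vfield0. Qed.

Lemma vfieldB X f g : X (f - g) = X f - X g :> S.
Proof. by rewrite vfieldD vfieldN. Qed.

Lemma vfield1 X : X 1 = 0 :> S.
Proof.
have h : (X 1 : S) = X 1 + X 1.
  transitivity (X (1 * 1) : S); first by congr (X _); rewrite mulr1.
  by rewrite vfieldM; congr (_ + _); [exact: mul1r|exact: mulr1].
by apply: (addrI (X 1 : S)); rewrite addr0 -h.
Qed.

Lemma vfieldP X Y : (forall f, X f = Y f :> S) -> X = Y.
Proof. by move=> XY; apply/val_inj/funext. Qed.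

Lemma oneformP al be : (forall X, al X = be X :> S) -> al = be.
Proof. by move=> ab; apply/val_inj/funext. Qed.

Lemma oneformD al X Y : al (X + Y) = al X + al Y :> S.
Proof. by have := oneform_linear al 1 X Y; rewrite !scale1r. Qed.

Lemma oneform0 al : al 0 = 0 :> S.
Proof. by apply: (addrI (al 0 : S)); rewrite addr0 -[LHS]oneformD addr0. Qed.

Lemma oneformZ al f X : al (f *: X) = f * al X :> S.
Proof. by have := oneform_linear al f X 0; rewrite oneform0 !addr0. Qed.

Lemma oneformN al X : al (- X) = - al X :> S.
Proof. by rewrite -scaleN1r oneformZ mulN1r. Qed.

Lemma formDE al be X : (al + be) X = al X + be X :> S. Proof. by []. Qed.
Lemma form0E X : (0 : oneform M) X = 0 :> S. Proof. by []. Qed.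
Lemma vfield0E f : (0 : vfield M) f = 0 :> S. Proof. by []. Qed.
Lemma formNE al X : (- al) X = - al X :> S. Proof. by []. Qed.
Lemma formZE f al X : (f *: al) X = f * al X :> S. Proof. by []. Qed.
Lemma vfieldDE X Y f : (X + Y) f = X f + Y f :> S. Proof. by []. Qed.
Lemma vfieldNE X f : (- X) f = - X f :> S. Proof. by []. Qed.
Lemma lieformE X al Y : lieform X al Y = X (al Y) - al (vlie X Y) :> S.
Proof. by []. Qed.

Lemma vlieE X Y f : vlie X Y f = X (Y f) - Y (X f) :> S. Proof. by []. Qed.

Lemma dfunE f X : dfun f X = X f :> S. Proof. by []. Qed.

Lemma vlieC X Y : vlie X Y = - vlie Y X.
Proof. by apply: vfieldP => f; rewrite vfieldNE !vlieE opprB. Qed.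

Lemma lieform_dfun X f : lieform X (dfun f) = dfun (X f).
Proof.
apply: oneformP => Y; rewrite lieformE.
by change ((X (Y f) : S) - (X (Y f) - Y (X f)) = Y (X f)); rewrite subKr.
Qed.

Lemma lieformD X al be : lieform X (al + be) = lieform X al + lieform X be.
Proof.
apply: oneformP => Y; rewrite formDE !lieformE.
change (X ((al Y : S) + be Y) - ((al (vlie X Y) : S) + be (vlie X Y)) =
  (X (al Y) : S) - al (vlie X Y) + ((X (be Y) : S) - be (vlie X Y))).
by rewrite vfieldD opprD addrACA.
Qed.

Lemma lieformZ X f al : lieform X (f *: al) = f *: lieform X al + (X f : S) *: al.
Proof.
apply: oneformP => Y.
change (X (f * al Y) - f * al (vlie X Y) =
  f * ((X (al Y) : S) - al (vlie X Y)) + (X f : S) * al Y).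
by rewrite vfieldM mulrBr addrAC.
Qed.

Lemma vlie_jacobi X Y Z : vlie X (vlie Y Z) = vlie (vlie X Y) Z + vlie Y (vlie X Z).
Proof.
apply: vfieldP => f; rewrite vfieldDE !vlieE !vfieldB.
move: (X (Y (Z f)) : S) (X (Z (Y f)) : S) (Y (Z (X f)) : S) (Z (Y (X f)) : S)
  (Y (X (Z f)) : S) (Z (X (Y f)) : S) => x1 x2 x3 x4 x5 x6.
ring.
Qed.

Lemma lieform_vlie X Y al :
  lieform (vlie X Y) al = lieform X (lieform Y al) - lieform Y (lieform X al).
Proof.
apply: oneformP => Z; rewrite formDE formNE !lieformE !vlieE !vfieldB.
(* The iterated bracket is the one term that does not match formally; the Jacobi identity splits it
   into the two nested brackets produced on the right. *)
have -> : al (vlie (vlie X Y) Z) = (al (vlie X (vlie Y Z)) : S) - al (vlie Y (vlie X Z)).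
  by rewrite (vlie_jacobi X Y Z) oneformD addrK.
move: (X (Y (al Z)) : S) (Y (X (al Z)) : S) (X (al (vlie Y Z)) : S)
  (Y (al (vlie X Z)) : S) (al (vlie X (vlie Y Z)) : S)
  (al (vlie Y (vlie X Z)) : S) => x1 x2 x3 x4 x5 x6.
ring.
Qed.

Lemma dfunB f g : dfun (f - g) = dfun f - dfun g.
Proof. by apply: oneformP => X; exact: (vfieldB X). Qed.

End FieldsAndForms.

(** * Wedge, contraction and Lie derivative on functions of argument sequences *)

Section Wedge.
Variables (R : realType) (M : manifold R) (T : Type).
Local Notation S := (Cinf M).
Implicit Types (P Q : seq T -> S) (s : seq T) (a b : T) (f : S).

(* The sign that makes contraction a graded derivation of the wedge product. *)
Definition eps P : seq T -> S := fun s => (-1) ^+ size s * P s.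

Lemma wedge_nil P Q : wedge P Q [::] = P [::] * Q [::].
Proof.
rewrite /wedge (big_pred1 [tuple]) /=; last by move=> t; apply/esym/eqP; exact: tuple0.
by rewrite /inversions big_ord0 mul1r.
Qed.

(** Masks are split by the destination of the first argument. If it goes to [Q], it crosses every
    argument given to [P], and [eps P] absorbs that sign. This recursion replaces shuffle sums in
    most of the later arguments on [wedge]. *)
Lemma wedge_cons P Q a s :
  wedge P Q (a :: s) = wedge (contr a P) Q s + wedge (eps P) (contr a Q) s.
Proof.
rewrite {1}/wedge /= big_tuple_cons; congr (_ + _); apply: eq_bigr => m _ /=.
  by rewrite inversions_cons.
rewrite inversions_cons mul1n exprD /eps /contr size_mask ?size_tuple //.
by rewrite -!mulrA; ring.
Qed.

Lemma addsE P Q s : (P + Q) s = P s + Q s. Proof. by []. Qed.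

Lemma oppsE P s : (- P) s = - P s. Proof. by []. Qed.

Definition fmul f P : seq T -> S := fun s => f * P s.

Lemma contr_wedge P Q a :
  contr a (wedge P Q) = wedge (contr a P) Q + wedge (eps P) (contr a Q).
Proof. by apply/funext => s; exact: wedge_cons. Qed.

Lemma wedgeDl P P' Q : wedge (P + P') Q = wedge P Q + wedge P' Q.
Proof.
apply/funext => s; rewrite [RHS]/GRing.add /= /wedge -big_split /=.
by apply: eq_bigr => m _; rewrite -mulrDl -mulrDr.
Qed.

Lemma wedgeDr P Q Q' : wedge P (Q + Q') = wedge P Q + wedge P Q'.
Proof.
apply/funext => s; rewrite [RHS]/GRing.add /= /wedge -big_split /=.
by apply: eq_bigr => m _; rewrite -mulrDr.
Qed.

Lemma wedge_fmull f P Q : wedge (fmul f P) Q = fmul f (wedge P Q).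
Proof.
apply/funext => s; rewrite /fmul /wedge big_distrr /=.
by apply: eq_bigr => m _; rewrite !mulrA (mulrC f).
Qed.

Lemma wedge_fmulr f P Q : wedge P (fmul f Q) = fmul f (wedge P Q).
Proof.
apply/funext => s; rewrite /fmul /wedge big_distrr /=.
by apply: eq_bigr => m _; rewrite mulrCA.
Qed.

Lemma fmulN1 P : fmul (-1) P = - P.
Proof. by apply/funext => s; rewrite /fmul mulN1r. Qed.

Lemma fmul0 P : fmul 0 P = 0.
Proof. by apply/funext => s; rewrite /fmul mul0r. Qed.

Lemma wedgeNl P Q : wedge (- P) Q = - wedge P Q.
Proof. by rewrite -fmulN1 wedge_fmull fmulN1. Qed.

Lemma wedgeNr P Q : wedge P (- Q) = - wedge P Q.
Proof. by rewrite -fmulN1 wedge_fmulr fmulN1. Qed.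

Lemma wedge0l Q : wedge 0 Q = 0.
Proof. by rewrite -{1}(fmul0 0) wedge_fmull fmul0. Qed.

Lemma wedge0r P : wedge P 0 = 0.
Proof. by rewrite -{1}(fmul0 0) wedge_fmulr fmul0. Qed.

Lemma epsK : involutive eps.
Proof. by move=> P; apply/funext => s; rewrite /eps mulrA -expr2 sqrr_sign mul1r. Qed.

Lemma contr_eps a P : contr a (eps P) = - eps (contr a P).
Proof. by apply/funext => s; rewrite /contr /eps /= exprS -mulrA mulN1r. Qed.

Lemma eps_sec0 f : eps (sec0 f) = sec0 f :> (seq T -> S).
Proof. by apply/funext; case=> [|a s]; rewrite /eps /= ?mul1r ?mulr0. Qed.

Lemma wedge_sec0l f P : wedge (sec0 f) P = fmul f P.
Proof.
apply/funext => s; elim: s P => [|a s IH] P; first by rewrite wedge_nil.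
by rewrite wedge_cons [contr a _](_ : _ = 0) // wedge0l eps_sec0 IH add0r.
Qed.

Lemma wedge_sec0r f P : wedge P (sec0 f) = fmul f P.
Proof.
apply/funext => s; elim: s P => [|a s IH] P; first by rewrite wedge_nil mulrC.
by rewrite wedge_cons [contr a (sec0 f)](_ : _ = 0) // wedge0r IH addr0.
Qed.

(* For D the Lie derivative along X on sections of the dual, this is the Lie
   derivative along X on multisections; peeling off one argument at a time is
   what lets it be compared with wedge. *)
Fixpoint lieD (X : vfield M) (D : T -> T) P s {struct s} : S :=
  if s is a :: s' then lieD X D (contr a P) s' - P (D a :: s') else X (P [::]).

Variables (X : vfield M) (D : T -> T).
Local Notation L := (lieD X D).

Lemma contr_lieD a P : contr a (L P) = L (contr a P) - contr (D a) P.
Proof. by []. Qed.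

Lemma lieDD P Q : L (P + Q) = L P + L Q.
Proof.
apply/funext => s; elim: s P Q => [|a s IH] P Q; first exact: vfieldD.
have -> : (L P + L Q) (a :: s) = L P (a :: s) + L Q (a :: s) by [].
rewrite /= [contr a _](_ : _ = contr a P + contr a Q) // IH.
by rewrite addrACA -opprD.
Qed.

Lemma lieD0 : L 0 = 0.
Proof. by apply: (addrI (L 0)); rewrite -lieDD !addr0. Qed.

Lemma lieDN P : L (- P) = - L P.
Proof.
apply/funext => s; elim: s P => [|a s IH] P; first exact: vfieldN.
have -> : (- L P) (a :: s) = - L P (a :: s) by [].
by rewrite /= [contr a _](_ : _ = - contr a P) // IH opprD.
Qed.

(** The Lie derivative preserves the number of arguments, hence the degree sign. *)
Lemma eps_lieD P : eps (L P) = L (eps P).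
Proof.
apply/funext => s; elim: s P => [|a s IH] P.
  by rewrite /eps /= !mul1r.
rewrite /= contr_eps lieDN -[(- _) s]/(- (L (eps (contr a P)) s)) -IH /eps /=.
by rewrite mulrBr {1}exprS -mulrA mulN1r.
Qed.

(** Without arguments this is the Leibniz rule of [X]. Otherwise one argument is peeled off:
    contraction is a graded derivation of [wedge], and its commutator with [L] is again a
    contraction, so both sides obey the same recursion. *)
Lemma lieD_wedge P Q : L (wedge P Q) = wedge (L P) Q + wedge P (L Q).
Proof.
apply/funext => s; elim: s P Q => [|a s IH] P Q.
  by rewrite addsE /= !wedge_nil /= vfieldM addrC.
rewrite /= contr_wedge lieDD !addsE !IH !wedge_cons !contr_lieD eps_lieD.
rewrite !wedgeDl !wedgeDr !wedgeNl !wedgeNr !addsE !oppsE.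
move: (wedge _ _ s) (wedge _ _ s) (wedge _ _ s) (wedge _ _ s) (wedge _ _ s)
  (wedge _ _ s) => x1 x2 x3 x4 x5 x6.
by ring.
Qed.

Lemma lieD_sec0 f : L (sec0 f) = sec0 (X f).
Proof.
apply/funext => -[|a s] //=; rewrite subr0 [contr _ _](_ : _ = 0) //.
by rewrite lieD0.
Qed.

Lemma lieD_fmul f P : L (fmul f P) = fmul (X f) P + fmul f (L P).
Proof. by rewrite -!wedge_sec0l lieD_wedge lieD_sec0. Qed.

(** The recursion unrolled into the usual formula for a Lie derivative, the form that Cartan's
    formula produces. *)
Lemma lieD_sum P s : L P s =
  X (P s) - \sum_(i < size s)
    P (take i s ++ D (tnth (in_tuple s) i) :: drop i.+1 s).
Proof.
elim: s P => [|a s IH] P; first by rewrite big_ord0 subr0.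
rewrite /= IH big_ord_recl /= drop0 opprD addrA [RHS]addrAC.
congr (_ - _ - _); apply: eq_bigr => i _.
by rewrite /contr !(tnth_nth a).
Qed.

End Wedge.

(** * Sections as multisections of degree one *)

Section Sections.
Variables (R : realType) (M : manifold R) (V W : Type) (pairing : V -> W -> Cinf M).
Local Notation S := (Cinf M).
Local Notation sec1 := (sec1 pairing).
Implicit Types (P Q : seq W -> S) (U : V) (a b : W) (s : seq W).

Lemma contr_sec1 a U : contr a (sec1 U) = sec0 (pairing U a).
Proof. by apply/funext => -[|b s]. Qed.

Lemma eps_sec1 U : eps (sec1 U) = - sec1 U.
Proof.
apply/funext => -[|a [|b s]]; rewrite oppsE /eps /= ?expr1 ?mulN1r //.
  by rewrite mulr0 oppr0.
by rewrite mulr0 oppr0.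
Qed.

(** With a factor of degree one, a shuffle is the choice of the argument paired with [U]; the same
    alternating sum occurs in [mvpair]. *)
Lemma wedge_sec1 U P s : wedge (sec1 U) P s =
  \sum_(i < size s)
    (-1) ^+ i * pairing U (tnth (in_tuple s) i) * P (delete i s).
Proof.
elim: s P => [|a s IH] P; first by rewrite wedge_nil big_ord0 mul0r.
rewrite wedge_cons contr_sec1 wedge_sec0l eps_sec1 wedgeNl oppsE IH.
rewrite big_ord_recl /= mul1r /delete /= drop0 -sumrN; congr (_ + _).
by apply: eq_bigr => i _; rewrite !(tnth_nth a) /= exprS !mulN1r !mulNr.
Qed.

Lemma lieD_sec1 (X : vfield M) (D : W -> W) U U' :
  (forall a, X (pairing U a) - pairing U (D a) = pairing U' a) ->
  lieD X D (sec1 U) = sec1 U'.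
Proof.
move=> UU'; apply/funext => -[|a s] /=; first exact: vfield0.
rewrite contr_sec1 lieD_sec0 -UU'; case: s => //= _ _.
by rewrite subr0.
Qed.

Lemma multisection_off k P s : multisection pairing k P -> size s != k -> P s = 0.
Proof.
have wedge_off (l : seq V) s' : size s' != size l ->
    foldr (@wedge _ _ W) (sec0 1) [seq sec1 X | X <- l] s' = 0.
  elim: l s' => [|U l IH] [|a s'] //=; first by rewrite wedge_nil mul0r.
  rewrite eqSS => sl; rewrite wedge_sec1 big1 // => i _; rewrite IH ?mulr0 //.
  by rewrite size_delete.
move=> [l ->] sk; rewrite big1 // => t _.
by rewrite wedge_off ?mulr0 // size_tuple.
Qed.

End Sections.

(** * Multisections: induction, bracket with a section, alternation *)

Section Multisections.
Variables (R : realType) (M : manifold R) (V W : Type) (pairing : V -> W -> Cinf M).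
Local Notation S := (Cinf M).
Local Notation sec1 := (sec1 pairing).
Local Notation multisection := (multisection pairing).
Implicit Types (P Q : seq W -> S) (U : V) (a b : W) (s : seq W) (f : S).

Lemma multisection0 k : multisection k 0.
Proof. by exists [::]; apply/funext => s; rewrite big_nil. Qed.

Lemma multisectionD k P Q :
  multisection k P -> multisection k Q -> multisection k (P + Q).
Proof.
move=> [l ->] [l' ->]; exists (l ++ l'); apply/funext => s.
by rewrite addsE big_cat.
Qed.

Lemma multisection_fmul k f P : multisection k P -> multisection k (fmul f P).
Proof.
move=> [l ->]; exists [seq (f * t.1, t.2) | t <- l]; apply/funext => s.
by rewrite big_map /fmul big_distrr; apply: eq_bigr => t _; rewrite /= mulrA.
Qed.

Lemma multisectionN k P : multisection k P -> multisection k (- P).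
Proof. by rewrite -fmulN1; exact: multisection_fmul. Qed.

Lemma multisection_sec0 f : multisection 0 (sec0 f).
Proof.
exists [:: (f, [tuple])]; apply/funext => s; rewrite big_seq1 /=.
by case: s => [|a s] /=; rewrite ?mulr1 ?mulr0.
Qed.

Lemma multisection_wedge1 k U P :
  multisection k P -> multisection k.+1 (wedge (sec1 U) P).
Proof.
move=> [l ->]; exists [seq (t.1, [tuple of U :: t.2]) | t : S * k.-tuple V <- l].
apply/funext => s; rewrite big_map /wedge /=.
under [RHS]eq_bigr do rewrite big_distrr /=.
rewrite exchange_big /=; apply: eq_bigr => m _; rewrite big_distrr /=.
by apply: eq_bigr => t _; rewrite mulrCA.
Qed.

Lemma multisection_sec1 U : multisection 1 (sec1 U).
Proof.
have -> : sec1 U = wedge (sec1 U) (sec0 1).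
  by rewrite wedge_sec0r; apply/funext => s; rewrite /fmul mul1r.
exact/multisection_wedge1/multisection_sec0.
Qed.

(** Induction along the generators: the unit function, wedges with a section, function multiples and
    sums. Membership is carried along because the axioms of the Schouten bracket apply to
    multisections only. *)
Lemma multisection_rect (K : nat -> (seq W -> S) -> Prop) :
  (forall k, K k 0) ->
  (forall k P Q, multisection k P -> K k P -> multisection k Q -> K k Q ->
    K k (P + Q)) ->
  (forall k f P, multisection k P -> K k P -> K k (fmul f P)) ->
  K 0%N (sec0 1) ->
  (forall k U P, multisection k P -> K k P -> K k.+1 (wedge (sec1 U) P)) ->
  forall k P, multisection k P -> K k P.
Proof.
move=> K0 KD KM Ks KW.
pose w (l : seq V) := foldr (@wedge _ _ W) (sec0 1) [seq sec1 X | X <- l].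
have Kw l : multisection (size l) (w l) /\ K (size l) (w l).
  elim: l => [|U l [ml Kl]]; first by split; [exact: multisection_sec0|].
  by split; [exact: multisection_wedge1|exact: KW].
have {}Kw k (t : k.-tuple V) : multisection k (w t) /\ K k (w t).
  by have := Kw t; rewrite size_tuple.
move=> k P [l ->]; pose sum (l : seq (S * k.-tuple V)) := fun s => \sum_(t <- l) t.1 * w t.2 s.
suff: multisection k (sum l) /\ K k (sum l) by case.
elim: l => [|t l [ml Kl]].
  have -> : sum [::] = 0 by apply/funext => s; rewrite /sum big_nil.
  by split; [exact: multisection0|].
have -> : sum (t :: l) = fmul t.1 (w t.2) + sum l.
  by apply/funext => s; rewrite /sum big_cons.
have [mt Kt] := Kw k t.2.
have mft := multisection_fmul t.1 mt.
by split; [exact: multisectionD|apply: KD => //; exact: KM].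
Qed.

Section Schouten.
Variables (rho : V -> vfield M) (br : V -> V -> V) (Ld : V -> W -> W).
Hypothesis LdE : forall U V a,
  rho U (pairing V a) - pairing V (Ld U a) = pairing (br U V) a.
Variable sb : (seq W -> S) -> (seq W -> S) -> (seq W -> S).
Hypothesis sbP : is_schouten pairing rho br sb.

(** Both sides are derivations of [wedge]. They agree on functions through the anchor, and on
    sections because [LdE] makes [Ld U] dual to [br U]; functions and sections generate
    everything. *)
Lemma schouten_lieD U k P : multisection k P ->
  sb (sec1 U) P = lieD (rho U) (Ld U) P.
Proof.
have m1 := multisection_sec1 U.
have sb0 : sb (sec1 U) 0 = 0.
  have := schouten_linearr sbP 1 m1 (multisection0 0) (multisection0 0).
  rewrite !scale1r addr0 => h.
  by apply: (addrI (sb (sec1 U) 0)); rewrite addr0.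
have sbW k' k'' Q Q' : multisection k' Q -> multisection k'' Q' ->
    sb (sec1 U) (wedge Q Q') = wedge (sb (sec1 U) Q) Q' + wedge Q (sb (sec1 U) Q').
  move=> mQ mQ'; rewrite (schouten_wedge sbP m1 mQ mQ').
  (* The first argument has degree 1, so the sign exponent is [k' * 2], which is even. *)
  by rewrite mulnC exprM sqrrN expr1n expr1n scale1r.
move: k P; apply: multisection_rect => [k|k P Q mP IHP mQ IHQ|k f P mP IH||k U' P mP IH].
- by rewrite sb0 lieD0.
- have := schouten_linearr sbP 1 m1 mP mQ.
  by rewrite !scale1r lieDD IHP IHQ.
- rewrite -wedge_sec0l (sbW _ _ _ _ (multisection_sec0 f) mP) lieD_wedge.
  by rewrite (schouten_fun sbP) lieD_sec0 IH.
- by rewrite (schouten_fun sbP) lieD_sec0.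
- rewrite (sbW _ _ _ _ (multisection_sec1 U') mP) lieD_wedge IH.
  by rewrite (schouten_sec sbP) (lieD_sec1 (U' := br U U')).
Qed.

End Schouten.

Definition alternating P := forall s1 a b s2,
  P (s1 ++ a :: b :: s2) = - P (s1 ++ b :: a :: s2).

Lemma alternating_contr a P : alternating P -> alternating (contr a P).
Proof. by move=> aP s1; exact: (aP (a :: s1)). Qed.

Lemma alternating_eps P : alternating P -> alternating (eps P).
Proof.
by move=> aP s1 a b s2; rewrite /eps aP mulrN !size_cat.
Qed.

(** Once the swapped pair is at the head, both arguments are peeled off. If they go to the same
    factor, its alternation gives the sign; the two mixed terms trade places, with the sign coming
    from [contr_eps]. *)
Lemma alternating_wedge P Q :
  alternating P -> alternating Q -> alternating (wedge P Q).
Proof.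
move=> aP aQ s1 a b s2; elim: s1 P Q aP aQ => [|c s1 IH] P Q aP aQ /=.
  have swap P' x y : alternating P' -> contr x (contr y P') = - contr y (contr x P').
    by move=> aP'; apply/funext => s; exact: (aP' [::] y x s).
  rewrite !wedge_cons !epsK !contr_eps !wedgeNl !oppsE.
  rewrite (swap _ b a aP) (swap _ b a aQ) wedgeNl wedgeNr !oppsE.
  by rewrite !opprD !opprK !addrA; congr (_ + _); rewrite addrAC.
by rewrite !wedge_cons opprD !IH //; (try exact: alternating_contr);
  exact: alternating_eps.
Qed.

Lemma multisection_alternating k P : multisection k P -> alternating P.
Proof.
move: k P; apply: multisection_rect => [k|k P Q _ aP _ aQ|k f P _ aP||k U' P _ aP].
- by move=> s1 a b s2; rewrite oppr0.
- by move=> s1 a b s2; rewrite !addsE aP aQ opprD.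
- by move=> s1 a b s2; rewrite /fmul aP mulrN.
- by move=> [|c s1] a b s2; rewrite oppr0.
- by apply: alternating_wedge => // -[|c [|d s1]] a b s2; rewrite oppr0.
Qed.

Lemma alternating_move P s1 a s2 : alternating P ->
  P (s1 ++ a :: s2) = (-1) ^+ size s1 * P (a :: s1 ++ s2).
Proof.
move=> aP; elim/last_ind: s1 s2 => [|s1 b IH] s2; first by rewrite mul1r.
rewrite -!cats1 -!catA /= aP IH size_cat addn1 exprS mulN1r.
by rewrite mulNr.
Qed.

End Multisections.

(** * Cartan's formula *)

Lemma big_ord_lt_recl (V : nmodType) n (F : 'I_n.+1 -> 'I_n.+1 -> V) :
  \sum_(i < n.+1) \sum_(j < n.+1 | (i < j)%N) F i j =
  \sum_(j < n) F ord0 (lift ord0 j) +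
  \sum_(i < n) \sum_(j < n | (i < j)%N) F (lift ord0 i) (lift ord0 j).
Proof.
rewrite big_ord_recl; congr (_ + _).
  by rewrite big_mkcond big_ord_recl /= add0r.
by apply: eq_bigr => i _; rewrite big_mkcond big_ord_recl /= add0r -big_mkcond.
Qed.

(** In the differential evaluated on [x :: s], the terms where [x] stays a plain argument of [omega]
    cancel the differential of the contraction ([d3] with [d1], [d5] with [d2]). The anchor of [x]
    and the brackets with [x] remain, and they form the Lie derivative. *)
Lemma cartan (R : realType) (M : manifold R) (V : Type) (rho : V -> vfield M)
    (br : V -> V -> V) (omega : seq V -> Cinf M) (x : V) :
  alternating omega ->
  differential rho br (contr x omega) + contr x (differential rho br omega) =
  lieD (rho x) (br x) omega.
Proof.
move=> aomega; apply/funext => s; rewrite addsE /contr /differential /=.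
rewrite big_ord_lt_recl big_ord_recl mul1r lieD_sum /=.
rewrite [delete 0 _](_ : _ = s); last by rewrite /delete /= drop0.
set d1 := \sum_(i < size s) _; set d2 := \sum_(i < size s) _.
set d3 := \sum_(i < size s) _; set d4 := \sum_(i < size s) _.
set d5 := \sum_(i < size s) _; set d6 := \sum_(i < size s) _.
have -> : d3 = - d1.
  rewrite -sumrN; apply: eq_bigr => i _.
  by rewrite !(tnth_nth x) exprS mulN1r mulNr.
have -> : d5 = - d2.
  rewrite -sumrN; apply: eq_bigr => i _; rewrite -sumrN; apply: eq_bigr => j _.
  by rewrite !(tnth_nth x) /= addnS !exprS !mulN1r opprK (aomega [::]) mulrN.
(* The bracket of [x] with argument [j] stands in front in [d4] and at place [j] in [d6]; moving it
   costs the sign of [j] transpositions. *)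
have -> : d4 = - d6.
  rewrite -sumrN; apply: eq_bigr => j _.
  rewrite (alternating_move _ _ _ aomega) size_take ltn_ord.
  rewrite add0n !(tnth_nth x) exprS mulN1r mulNr.
  by rewrite /delete /= drop0.
ring.
Qed.

(** * Degree and contraction of multisections *)

Section Degree.
Variables (R : realType) (M : manifold R) (V W : Type) (pairing : V -> W -> Cinf M).
Local Notation S := (Cinf M).
Local Notation sec1 := (sec1 pairing).
Local Notation multisection := (multisection pairing).
Implicit Types (P Q : seq W -> S) (U : V) (a b : W) (s : seq W) (f : S).

Lemma multisection_degree0 P : multisection 0 P -> P = sec0 (P [::]).
Proof.
by move=> mP; apply/funext; case=> [|a s] //; exact: multisection_off mP _.
Qed.

Lemma eq_multisection k P Q : multisection k P -> multisection k Q ->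
  (forall s, size s = k -> P s = Q s) -> P = Q.
Proof.
move=> mP mQ PQ; apply/funext => s; have [/PQ//|sk] := eqVneq (size s) k.
by rewrite (multisection_off mP sk) (multisection_off mQ sk).
Qed.

Lemma multisection_contr k a P : multisection k.+1 P -> multisection k (contr a P).
Proof.
have ms0 := multisection0 pairing.
move Dk: k.+1 => k1 mP; move: k1 P mP k Dk.
apply: multisection_rect => [k|k P Q _ IHP _ IHQ|k f P _ IH||k U P mP IH] k' Dk //.
- by apply: (multisectionD (P := contr a P)); [exact: IHP|exact: IHQ].
- by apply: (multisection_fmul f (P := contr a P)); exact: IH.
- case: Dk => Dk; subst k'.
  rewrite contr_wedge contr_sec1 wedge_sec0l eps_sec1 wedgeNl.
  apply: multisectionD; first exact: multisection_fmul.
  (* In degree 0 the induction hypothesis is void, and the contraction of a function is 0. *)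
  apply: multisectionN; case: k mP IH => [|k] mP IH.
    by rewrite (multisection_degree0 mP) [contr _ _](_ : _ = 0) // wedge0r.
  by apply: multisection_wedge1; exact: IH.
Qed.

(** [W] is a bare type, so opposite actions on it are compared through the pairing; this suffices on
    multisections, which are generated by functions and sections. *)
Lemma lieD_opp (X X' : vfield M) (D D' : W -> W) k P :
  (forall f, X' f = - X f :> S) ->
  (forall U a, pairing U (D' a) = - pairing U (D a)) ->
  multisection k P -> lieD X' D' P = - lieD X D P.
Proof.
move=> XX' DD'; move: k P.
apply: multisection_rect => [k|k P Q _ IHP _ IHQ|k f P _ IH||k U P _ IH].
- by rewrite !lieD0 oppr0.
- by rewrite !lieDD IHP IHQ opprD.
- rewrite !lieD_fmul IH XX'; apply/funext => s.
  by rewrite !(addsE, oppsE) /fmul !mulNr opprD mulrN.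
- rewrite !lieD_sec0 XX'; apply/funext => -[|a s] //.
  by rewrite oppsE oppr0.
- rewrite !lieD_wedge IH wedgeNr opprD -[- wedge (lieD _ _ _) _]wedgeNl; congr (wedge _ _ + _).
  apply/funext => -[|a s] /=; rewrite oppsE /=.
    by rewrite XX'.
  rewrite contr_sec1 !lieD_sec0 XX'; case: s => [|b s] /=.
    by rewrite DD' opprD.
  by rewrite subr0 oppr0.
Qed.

End Degree.

(** * The bundle T M x R, the sharp map, and statement (ii) *)

Lemma wedge_map (R : realType) (M : manifold R) (T T' : Type) (h : T -> T')
    (P Q : seq T' -> Cinf M) :
  (fun s => wedge P Q (map h s)) =
  wedge (fun s => P (map h s)) (fun s => Q (map h s)).
Proof.
apply/funext => s; elim: s P Q => [|a s IH] P Q; first by rewrite !wedge_nil.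
rewrite [LHS]wedge_cons [RHS]wedge_cons.
congr (_ + _); first exact: IH.
rewrite [LHS]IH; congr (wedge _ _ s).
by apply/funext => s'; rewrite /eps size_map.
Qed.

Section TangentPlusR.
Variables (R : realType) (M : manifold R).
Local Notation S := (Cinf M).
Local Notation tsec1 := (sec1 (@tmr_pairing R M)).
Local Notation tmsec := (multisection (@tmr_pairing R M)).
Implicit Types (X Y : vfield M) (f g : S) (al be : oneform M).

(** The Lie derivative of T M x R on its dual, obtained by solving the Leibniz rule for the pairing,
    which [tmr_LieE] checks. *)
Definition tmr_Lie (U : tmr M) (a : tmr_dual M) : tmr_dual M :=
  (lieform U.1 a.1 + a.2 *: dfun U.2, U.1 a.2).

Lemma tmr_LieE U V a :
  tmr_anchor U (tmr_pairing V a) - tmr_pairing V (tmr_Lie U a) =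
  tmr_pairing (tmr_bracket U V) a.
Proof.
case: U V a => [X f] [Y g] [al p].
change (X ((al Y : S) + p * g) -
  ((X (al Y) : S) - al (vlie X Y) + p * Y f + (X p : S) * g) =
  (al (vlie X Y) : S) + p * ((X g : S) - Y f)).
rewrite vfieldD vfieldM.
move: (X (al Y) : S) (X g : S) (X p : S) (al (vlie X Y) : S) (Y f : S).
move=> x1 x2 x3 x4 x5; ring.
Qed.

Lemma multisection_tmr k P : multivector k P -> tmsec k (fun s => P (map fst s)).
Proof.
have ms0 := multisection0 (@tmr_pairing R M).
move: k P; apply: multisection_rect => [k|k P Q _ IHP _ IHQ|k f P _ IH||k U P _ IH].
- exact: ms0.
- exact: multisectionD IHP IHQ.
- exact: (multisection_fmul f IH).
- rewrite (_ : (fun _ => _) = sec0 1); first exact: multisection_sec0.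
  by apply/funext; case.
- rewrite wedge_map (_ : (fun _ => sec1 _ _ _) = tsec1 (U, 0)).
    exact: multisection_wedge1.
  by apply/funext => -[|a [|b s]] //=; rewrite /tmr_pairing mulr0 addr0.
Qed.

(** The second component enters as a wedge with the section [(0, 1)] of T M x R, which shows that
    pairs are multisections. *)
Lemma mvpairE P Q : mvpair P Q =
  (fun s => P (map fst s)) + wedge (tsec1 (0, 1)) (fun s => Q (map fst s)).
Proof.
apply/funext => s; rewrite addsE wedge_sec1 /mvpair; congr (_ + _).
apply: eq_bigr => i _; rewrite /tmr_pairing /=.
by rewrite oneform0 add0r mulr1.
Qed.

Lemma multisection_mvpair k P Q : multivector k P -> multivector_pred k Q ->
  tmsec k (mvpair P Q).
Proof.
move=> mP mQ; rewrite mvpairE; apply: multisectionD.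
  exact: multisection_tmr.
case: k mQ {mP} => [->|k mQ]; first by rewrite wedge0r; exact: multisection0.
by apply: multisection_wedge1; exact: multisection_tmr.
Qed.

Lemma multivector1 P : multivector 1 P -> exists X, P = sec1 (@tm_pairing R M) X.
Proof.
move Dk: 1%N => k mP; move: k P mP Dk.
apply: multisection_rect => [k|k P Q _ IHP _ IHQ|k f P _ IH||k X P mP _] Dk //.
- by exists 0; apply/funext => -[|a [|b s]] //=; rewrite /tm_pairing oneform0.
- have [[X ->] [Y ->]] := (IHP Dk, IHQ Dk); exists (X + Y).
  by apply/funext => -[|a [|b s]]; rewrite addsE /= ?addr0 // /tm_pairing oneformD.
- have [X ->] := IH Dk; exists (f *: X).
  apply/funext => -[|a [|b s]]; rewrite /fmul /= ?mulr0 // /tm_pairing.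
  by rewrite oneformZ.
- case: Dk => Dk; subst k; rewrite (multisection_degree0 mP) wedge_sec0r.
  exists (P [::] *: X); apply/funext => -[|a [|b s]]; rewrite /fmul /= ?mulr0 //.
  by rewrite /tm_pairing oneformZ.
Qed.

Variables (Lambda : seq (oneform M) -> S) (E : vfield M).
Hypothesis Lambda2 : multivector 2 Lambda.
Local Notation "'#" := (sharp Lambda) (at level 0).

(** Contracting [Lambda] with [al] leaves a 1-vector, hence a vector field, so the choice made in
    [sharp] does not fall back on its default 0. *)
Lemma sharpP al be : be ('# al) = Lambda [:: al; be] :> S.
Proof.
rewrite /sharp.
have [X LX] := multivector1 (multisection_contr al Lambda2).
have : exists X, [set X : vfield M | forall be, be X = Lambda [:: al; be]]%classic X.
  by exists X => be' /=; have := congr1 (fun P => P [:: be']) LX.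
by move=> /(@xgetPex _ 0) /(_ be).
Qed.

Lemma Lambda_anti al be : Lambda [:: al; be] = - Lambda [:: be; al].
Proof. exact: (multisection_alternating Lambda2 [::]). Qed.

Lemma LambdaDr al be ga :
  Lambda [:: al; be + ga] = Lambda [:: al; be] + Lambda [:: al; ga].
Proof. by rewrite -!sharpP. Qed.

Lemma LambdaZr al f be : Lambda [:: al; f *: be] = f * Lambda [:: al; be].
Proof. by rewrite -!sharpP. Qed.

Lemma LambdaDl al be ga :
  Lambda [:: be + ga; al] = Lambda [:: be; al] + Lambda [:: ga; al].
Proof. by rewrite [LHS]Lambda_anti LambdaDr opprD -!Lambda_anti. Qed.

Lemma LambdaZl al f be : Lambda [:: f *: be; al] = f * Lambda [:: be; al].
Proof. by rewrite [LHS]Lambda_anti LambdaZr -mulrN -Lambda_anti. Qed.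

Lemma sharp_fun al f : '# al f = Lambda [:: al; dfun f] :> S.
Proof. by rewrite -sharpP. Qed.

Lemma sharp0 : '# 0 = 0.
Proof. by apply: vfieldP => f; rewrite sharp_fun -(scale0r (0 : oneform M)) LambdaZl mul0r. Qed.

Lemma dual_anchor01 : dual_anchor Lambda E (0, 1) = E.
Proof. by rewrite /dual_anchor /= sharp0 add0r scale1r. Qed.

Lemma dual_bracket01 a : dual_bracket Lambda E (0, 1) a = (lieform E a.1, E a.2 : S).
Proof.
case: a => be g; rewrite -[(be, g).1]/be -[(be, g).2]/g /dual_bracket; cbv beta iota.
have L0 al : Lambda [:: al; 0] = 0 by rewrite -sharpP.
have lie0 X : lieform X 0 = 0.
  by apply: oneformP => Y; rewrite lieformE vfield0 subr0.
have d0 : dfun 0 = 0 :> oneform M by apply: oneformP => Y; exact: vfield0.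
have l0 : lieform 0 be = 0.
  apply: oneformP => Y; rewrite lieformE.
  have -> : vlie 0 Y = 0.
    by apply: vfieldP => f; rewrite [LHS](_ : _ = 0 - Y 0 :> S) // vfield0 subr0.
  by rewrite oneform0 subr0.
rewrite [Lambda [:: 0; be]]Lambda_anti !L0 sharp0 !lie0 l0 !oppr0 d0.
rewrite form0E vfield0E !vfield1.
congr pair; first by rewrite !scaler0 scale0r !subr0 !add0r scale1r.
by rewrite mulr0 !subr0 !add0r mul1r.
Qed.

Section Twisted.
Variable sb : (seq (tmr_dual M) -> S) -> (seq (tmr_dual M) -> S) ->
  (seq (tmr_dual M) -> S).
Hypothesis sbP :
  is_schouten (@tmr_pairing R M) (@tmr_anchor R M) (@tmr_bracket R M) sb.

(** The coefficient of the first correction is 1 - 1 = 0; in the second, contracting [U] with the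
    cocycle [(0, 1)] gives the function [U.2]. *)
Lemma twisted_schouten_sec1 U k P : tmsec k P ->
  twisted_schouten sb (0, 1) 1 k (tsec1 U) P =
  lieD U.1 (tmr_Lie U) P - ((k%:R - 1 : R) *: fmul U.2 P).
Proof.
move=> mP; rewrite /twisted_schouten subrr mulr0 scale0r addr0.
rewrite contr_sec1 wedge_sec0l (schouten_lieD tmr_LieE sbP U mP) /tmr_pairing /=.
by rewrite mul1r add0r.
Qed.

Lemma Lstar_schouten k P : tmsec k P ->
  Lstar Lambda E (0, 1) P +
  twisted_schouten sb (0, 1) 1 k (tsec1 (- E, 0)) P = 0.
Proof.
move=> mP; rewrite (twisted_schouten_sec1 _ mP) /= fmul0 scaler0 subr0.
rewrite /Lstar /twisted_Lie /twisted_differential.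
set phi := tsec1 _; set d := differential _ _.
have -> : contr (0, 1) (d P + wedge phi P) =
    contr (0, 1) (d P) + contr (0, 1) (wedge phi P) by [].
rewrite contr_wedge contr_sec1 eps_sec1 wedge_sec0l.
rewrite [tmr_pairing _ _](_ : _ = 0 + 1 * 0 :> S) // mulr0 addr0.
rewrite fmul0 add0r wedgeNl -/phi.
(* The wedges of [phi] with the contraction of [P] cancel, leaving the untwisted Lie derivative
   along [(0, 1)]. *)
rewrite addrACA subrr addr0 (cartan _ _ _ (multisection_alternating mP)).
rewrite dual_anchor01 [X in _ + X](lieD_opp (X := E)
  (D := dual_bracket Lambda E (0, 1)) _ _ mP) ?subrr //.
have vlieN X : vlie (- E) X = - vlie E X.
  apply: vfieldP => f.
  change (- (E (X f) : S) - X (- (E f : S)) = - ((E (X f) : S) - X (E f))).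
  by rewrite vfieldN opprB opprK addrC.
move=> [X f] [al p]; rewrite dual_bracket01.
change (- (E (al X) : S) - al (vlie (- E) X) + p * X 0 + - (E p : S) * f =
  - ((E (al X) : S) - al (vlie E X) + (E p : S) * f)).
rewrite vlieN oneformN vfield0 mulr0 addr0 mulNr opprK opprD opprB.
by congr (_ + _); rewrite addrC.
Qed.

End Twisted.
End TangentPlusR.

(** * The twisted differential of a section, and statement (i) on two arguments *)

Lemma differential_off (R : realType) (M : manifold R) (V : Type)
    (rho : V -> vfield M) (br : V -> V -> V) (omega : seq V -> Cinf M) (k : nat) s :
  (forall s, size s != k -> omega s = 0) -> size s != k.+1 ->
  differential rho br omega s = 0.
Proof.
move=> w0 sk; rewrite /differential !big1 ?addr0 // => i _.
  rewrite big1 // => j ij; have s0 := leq_ltn_trans (leq0n _) (ltn_ord j).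
  (* As [i < j], the index [i] is still valid after place [j] has been deleted. *)
  have n1 : (i < (size s).-1)%N by rewrite (leq_trans ij) // -ltnS prednK.
  rewrite w0 ?mulr0 //= !size_delete // prednK ?(leq_ltn_trans _ n1) //.
  by rewrite -eqSS prednK.
rewrite w0 ?vfield0 ?mulr0 // size_delete // -eqSS prednK //.
exact: leq_ltn_trans (leq0n _) (ltn_ord i).
Qed.

Section Dstar.
Variables (R : realType) (M : manifold R).
Local Notation S := (Cinf M).
Local Notation tsec1 := (sec1 (@tmr_pairing R M)).
Local Notation tmsec := (multisection (@tmr_pairing R M)).
Implicit Types (X Y : vfield M) (f g p q : S) (al be : oneform M).

Variables (Lambda : seq (oneform M) -> S) (E : vfield M).
Hypothesis Lambda2 : multivector 2 Lambda.
Local Notation "'#" := (sharp Lambda) (at level 0).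
Local Notation B al be := (Lambda [:: al; be]).

Lemma LambdaNr al be : B al (- be) = - B al be.
Proof. by rewrite -!(sharpP Lambda2). Qed.

Lemma LambdaNl al be : B (- al) be = - B al be.
Proof. by rewrite [LHS](Lambda_anti Lambda2) LambdaNr -(Lambda_anti Lambda2). Qed.

(** This is the definition of [lieform Y be] evaluated at [sharp Lambda al]; it trades brackets with
    sharps for values of [Lambda]. *)
Lemma bracket_sharp al be Y :
  be (vlie ('# al) Y) = B al (lieform Y be) - Y (B al be) :> S.
Proof.
rewrite vlieC oneformN -(sharpP Lambda2 al (lieform Y be)) lieformE.
by rewrite (sharpP Lambda2) addrAC subrr add0r.
Qed.

Definition dstarP (V : tmr M) : seq (oneform M) -> S :=
  fmul V.2 Lambda - lieD V.1 (lieform V.1) Lambda.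
Definition dstarQ (V : tmr M) : vfield M :=
  '# (dfun V.2) + vlie E V.1 + V.2 *: E.

(** The components [dstarP] and [dstarQ] evaluated on two arguments, with sharps eliminated so that
    identities become polynomial. *)
Definition dstar2 (V : tmr M) (a b : tmr_dual M) : S :=
  V.2 * B a.1 b.1 -
  ((V.1 (B a.1 b.1) : S) - B a.1 (lieform V.1 b.1) - B (lieform V.1 a.1) b.1)
  + (a.2 * (B (dfun V.2) b.1 + b.1 (vlie E V.1) + V.2 * b.1 E)
     - b.2 * (B (dfun V.2) a.1 + a.1 (vlie E V.1) + V.2 * a.1 E)).

Lemma mvpair2 V a b :
  mvpair (dstarP V) (sec1 (@tm_pairing R M) (dstarQ V)) [:: a; b] = dstar2 V a b.
Proof.
rewrite /mvpair !big_ord_recl big_ord0 addr0 /dstar2.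
rewrite !(tnth_nth a) expr0 expr1 mul1r mulN1r mulNr -!(sharpP Lambda2).
have Q (c : oneform M) : c (dstarQ V) = (c ('# (dfun V.2)) : S) + c (vlie E V.1) + V.2 * c E.
  by rewrite /dstarQ !oneformD oneformZ.
congr (_ + (_ - _)); first by rewrite !(sharpP Lambda2).
  by rewrite -Q.
by rewrite -Q.
Qed.

Lemma dstar_sec1_2 V a b :
  dstar Lambda E (tsec1 V) [:: a; b] = dstar2 V a b.
Proof.
case: V a b => [Y g] [al p] [be q].
set a := (al, p); set b := (be, q).
pose vb : S := (be Y : S) + q * g; pose va : S := (al Y : S) + p * g.
(* Two anchor terms, the single bracket term, and the twist by [(- E, 0)]. *)
have -> : dstar Lambda E (tsec1 (Y, g)) [:: a; b] =
  (('# al vb : S) + p * E vb - (('# be va : S) + q * E va))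
  - tmr_pairing (Y, g) (dual_bracket Lambda E a b)
  + ((al (- E) + p * 0) * vb - (be (- E) + q * 0) * va).
  rewrite /dstar /twisted_differential addsE wedge_sec1 /differential.
  rewrite big_ord_lt_recl !big_ord_recl !big_ord0 big_pred0 ?addr0; last by move=> [[|m] hm].
  by rewrite !(tnth_nth a) !expr0 !expr1 !mul1r !mulN1r mulNr.
have -> : tmr_pairing (Y, g) (dual_bracket Lambda E a b) =
  ('# al (be Y) : S) - be (vlie ('# al) Y) -
  (('# be (al Y) : S) - al (vlie ('# be) Y)) - Y (B al be)
  + p * ((E (be Y) : S) - be (vlie E Y)) - q * ((E (al Y) : S) - al (vlie E Y))
  - ((al E : S) * be Y - (be E : S) * al Y)
  + (B be al + '# al q - '# be p + p * E q - q * E p) * g.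
  by [].
rewrite !bracket_sharp /va /vb !vfieldD !vfieldM !oneformN !(sharp_fun Lambda2) /dstar2 /=.
(* Each value of [Lambda] is given one orientation, so that [ring] meets the same atoms on both
   sides. *)
rewrite (Lambda_anti Lambda2 be al) (Lambda_anti Lambda2 (lieform Y al) be).
rewrite !(Lambda_anti Lambda2 (dfun g)) vfieldN.
ring.
Qed.

Section Schouten.
Variable sbM : (seq (oneform M) -> S) -> (seq (oneform M) -> S) ->
  (seq (oneform M) -> S).
Hypothesis sbMP : is_schouten (@tm_pairing R M) (fun X => X) (@vlie R M) sbM.

(** The degree axiom of the Schouten bracket, transported along its identification with the Lie
    derivative. *)
Lemma multivector_lieD k P X :
  multivector k.+1 P -> multivector k.+1 (lieD X (lieform X) P).
Proof.
move=> mP; have LdE X' Y al : X' (tm_pairing Y al) - tm_pairing Y (lieform X' al) =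
    tm_pairing (vlie X' Y) al by exact: subKr.
rewrite -(schouten_lieD LdE sbMP X mP).
exact: (schouten_deg sbMP (multisection_sec1 _ X) mP).
Qed.

Lemma multisection_dstarPQ V :
  tmsec 2 (mvpair (dstarP V) (sec1 (@tm_pairing R M) (dstarQ V))).
Proof.
apply: multisection_mvpair; last exact: multisection_sec1.
apply: multisectionD; first exact: multisection_fmul.
by apply: multisectionN; exact: multivector_lieD.
Qed.

(** On two arguments this is the computation above; on other lengths both sides vanish. It shows
    that the differential of a section is a genuine 2-section. *)
Lemma dstar_sec1 V : dstar Lambda E (tsec1 V) =
  mvpair (dstarP V) (sec1 (@tm_pairing R M) (dstarQ V)).
Proof.
have mv := multisection_dstarPQ V.
apply/funext => s; have [|s2] := eqVneq (size s) 2%N.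
  by case: s => [|a [|b []]] // _; rewrite dstar_sec1_2 mvpair2.
rewrite (multisection_off mv s2) /dstar /twisted_differential addsE.
have m1 := multisection_sec1 (@tmr_pairing R M).
rewrite (differential_off _ _ (fun s' => multisection_off (m1 V) (s := s')) s2) add0r.
exact: multisection_off (multisection_wedge1 _ (m1 V)) s2.
Qed.

Lemma multisection_dstar_sec1 V : tmsec 2 (dstar Lambda E (tsec1 V)).
Proof. by rewrite dstar_sec1; exact: multisection_dstarPQ. Qed.

End Schouten.

(** Statement (i) on two arguments: each parenthesis is a twisted bracket with its [lieD] unrolled.
    Expanding Lie derivatives along [vlie X Y] as commutators leaves a polynomial identity. *)
Lemma dstar2_bracket U V a b : dstar2 (tmr_bracket U V) a b =
  ((U.1 (dstar2 V a b) : S) - dstar2 V a (tmr_Lie U b) - dstar2 V (tmr_Lie U a) b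
     - U.2 * dstar2 V a b)
  - ((V.1 (dstar2 U a b) : S) - dstar2 U a (tmr_Lie V b) - dstar2 U (tmr_Lie V a) b
     - V.2 * dstar2 U a b).
Proof.
case: U V a b => [X f] [Y g] [al p] [be q].
rewrite /dstar2 /tmr_bracket /tmr_Lie; cbv beta iota delta [fst snd].
rewrite !(lieformD, lieformZ, lieform_dfun, lieform_vlie, dfunB).
rewrite !(LambdaDl Lambda2, LambdaDr Lambda2, LambdaZl Lambda2, LambdaZr Lambda2,
  LambdaNl, LambdaNr).
(* The Jacobi identity moves [E] to the innermost bracket, and all brackets with [E] are oriented
   with [E] first. *)
rewrite !(formDE, formZE, dfunE, lieformE) (vlie_jacobi E X Y) (vlieC (vlie E X) Y).
rewrite (vlieC X E) (vlieC Y E) !(oneformD, oneformN) !vlieE.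
(* Normal form: Lambda against an exact form has it as its first argument. *)
rewrite !(Lambda_anti Lambda2 al (dfun _)).
rewrite !(Lambda_anti Lambda2 (lieform _ _) (dfun _)).
rewrite !(vfieldD, vfieldM, vfieldB, vfieldN).
ring.
Qed.

End Dstar.

(** * Assembly of both statements *)

Theorem proposition3p7 (R : realType) (M : manifold R)
  (sbM : (seq (oneform M) -> Cinf M) -> (seq (oneform M) -> Cinf M) ->
         (seq (oneform M) -> Cinf M))
  (sbM_schouten : is_schouten (@tm_pairing R M) (fun X => X) (@vlie R M) sbM)
  (sbA : (seq (tmr_dual M) -> Cinf M) -> (seq (tmr_dual M) -> Cinf M) ->
         (seq (tmr_dual M) -> Cinf M))
  (sbA_schouten :
    is_schouten (@tmr_pairing R M) (@tmr_anchor R M) (@tmr_bracket R M) sbA)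
  (Lambda : seq (oneform M) -> Cinf M) (E : vfield M)
  (jacobiM : is_jacobi sbM Lambda E) :
  (forall U V : tmr M,
     dstar Lambda E (sec1 (@tmr_pairing R M) (tmr_bracket U V)) =
     twisted_schouten sbA (0, 1) 1 2
       (sec1 (@tmr_pairing R M) U)
       (dstar Lambda E (sec1 (@tmr_pairing R M) V))
     - twisted_schouten sbA (0, 1) 1 2
         (sec1 (@tmr_pairing R M) V)
         (dstar Lambda E (sec1 (@tmr_pairing R M) U))) /\
  (forall (k : nat) (P Q : seq (oneform M) -> Cinf M),
     multivector k P -> multivector_pred k Q ->
     Lstar Lambda E (0, 1) (mvpair P Q)
     + twisted_schouten sbA (0, 1) 1 k
         (sec1 (@tmr_pairing R M) (- E, 0)) (mvpair P Q) = 0).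
Proof.
have [Lambda2 _ _] := jacobiM; split=> [U V|k P Q mP mQ]; last first.
  exact: (Lstar_schouten E Lambda2 sbA_schouten (multisection_mvpair mP mQ)).
have mS := multisection_dstar_sec1 E Lambda2 sbM_schouten.
have two1 : 2%:R - 1 = 1 :> R by rewrite addrK.
have twE W W' := twisted_schouten_sec1 sbA_schouten W (mS W').
rewrite !twE two1 !scale1r.
(* Both sides of (i) must be known to be 2-sections before a comparison on two arguments suffices;
   the degree axiom provides this for the Lie derivative. *)
have mT W W' : multisection (@tmr_pairing R M) 2
    (lieD W.1 (tmr_Lie W) (dstar Lambda E (sec1 (@tmr_pairing R M) W')) -
     fmul W.2 (dstar Lambda E (sec1 (@tmr_pairing R M) W'))).
  apply: multisectionD; last exact/multisectionN/multisection_fmul.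
  rewrite -(schouten_lieD (@tmr_LieE R M) sbA_schouten W (mS W')).
  exact: (schouten_deg sbA_schouten (multisection_sec1 _ W) (mS W') (erefl 3)).
apply: (eq_multisection (mS _)); first exact/multisectionD/multisectionN/mT/mT.
case=> [|a [|b []]] // _.
rewrite (dstar_sec1_2 E Lambda2) (dstar2_bracket E Lambda2).
by rewrite -!(dstar_sec1_2 E Lambda2).
Qed.
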